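(* Let $(\mathcal{A},\mathcal{A}_* )$ be a dual Banach algebra, and suppose that for all ultrafilters $\mathcal{U}$ we have $(\mathcal{A}_* )_{\mathcal{U}} \subseteq \operatorname{WAP}((\mathcal{A})_{\mathcal{U}}')$. Then every even dual of $\mathcal{A}$ (that is, $\mathcal{A}$, $\mathcal{A}''$, $\mathcal{A}''''$, and so on) is Arens regular.
   Context: $E'$ denotes the dual of a Banach space $E$. For an ultrafilter $\mathcal{U}$ on a set $I$, the ultrapower is $(E)_{\mathcal{U}} = \ell^\infty(E,I)/\{(x_i)_{i\in I} : \lim_{i\to\mathcal{U}}\|x_i\|=0\}$, with norm $\|(x_i)\|=\lim_{i\to\mathcal{U}}\|x_i\|$; if $\mathcal{A}$ is a Banach algebra, $(\mathcal{A})_{\mathcal{U}}$ is a Banach algebra under the pointwise product. A dual Banach algebra $(\mathcal{A},\mathcal{A}_* )$ is a Banach algebra $\mathcal{A}$ together with a Banach space $\mathcal{A}_*$ with $\mathcal{A}=(\mathcal{A}_* )'$ such that the product on $\mathcal{A}$ is separately weak$^*$-continuous. $(\mathcal{A}_* )_{\mathcal{U}}$ is identified with a subspace of $(\mathcal{A})_{\mathcal{U}}'$ by the pairing $\langle (\mu_i),(a_i)\rangle=\lim_{i\to\mathcal{U}}\langle a_i,\mu_i\rangle$. For a Banach algebra $\mathcal{B}$, $\mathcal{B}'$ is a $\mathcal{B}$-bimodule via $\langle a\cdot\mu,b\rangle=\langle\mu,ba\rangle$, $\langle\mu\cdot a,b\rangle=\langle\mu,ab\rangle$. $\operatorname{WAP}(\mathcal{B}')$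 is the set of $\mu\in\mathcal{B}'$ such that the map $\mathcal{B}\to\mathcal{B}'$, $a\mapsto a\cdot\mu$, is weakly compact. A Banach algebra is Arens regular if its first and second Arens products on the bidual coincide; the bidual is then a Banach algebra for this common product, and the even duals are given their algebra structures by iterating this. *)

(* Defs.v *)
From HB Require Import structures.
From mathcomp Require Import all_boot all_order all_algebra.
From mathcomp Require Import generic_quotient ring_quotient complex.
From mathcomp Require Import all_classical all_reals.
From mathcomp Require Import topology normedtype.

Set Implicit Arguments.
Unset Strict Implicit.
Unset Printing Implicit Defensive.

Import Order.TTheory GRing.Theory Num.Theory.
Import numFieldNormedType.Exports.

Local Open Scope classical_set_scope.
Local Open Scope ring_scope.

(** Banach spaces over the reals and over the complex numbers are both covered. *)

Variant scalar_kind := RealScalars | ComplexScalars.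

Definition complex_field (R : realType) : numFieldType := R[i]%C.

Definition scalar_field (R : realType) (s : scalar_kind) : numFieldType :=
  match s with RealScalars => R | ComplexScalars => complex_field R end.

Lemma complex_cvg (R : realType) (F : set_system (complex_field R))
    (FF : ProperFilter F) (z : complex_field R) :
  (@complex.Re R : complex_field R -> R) @ F --> complex.Re z -> (@complex.Im R : complex_field R -> R) @ F --> complex.Im z -> F --> z.
Proof.
move=> FR FI; apply/cvgrPdist_lt => e e0.
have er : e = (complex.Re e)%:C%C by rewrite RRe_real ?gtr0_real.
have e0' : 0 < complex.Re e / 2 by rewrite divr_gt0// -ltcR -er.
move/cvgrPdist_lt : FR => /(_ _ e0') FR; move/cvgrPdist_lt : FI => /(_ _ e0') FI.
apply: filterS2 FR FI => w wR wI.
rewrite er [_ - _]complexE (le_lt_trans (ler_normD _ _))//.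
rewrite normrM (_ : `|'i%C| = 1); last first.
  by rewrite normc_def /= expr0n /= add0r expr1n sqrtr1.
have nR (x : R) : `|(x%:C)%C| = (`|x|%:C)%C.
  by rewrite normc_def /= expr0n /= addr0 sqrtr_sqr.
rewrite mul1r !nR -rmorphD /= ltcR [ltRHS]splitr ltrD//.
  by case: (z) (w) wR => [? ?] [? ?].
by case: (z) (w) wI => [? ?] [? ?].
Qed.

Section Scalars.
Context {R : realType} {s : scalar_kind}.
Local Notation K := (scalar_field R s).

Lemma scalar_supremums (A : set K) (M : K) :
  A !=set0 -> (forall a, A a -> 0 <= a) -> ubound A M -> supremums A !=set0.
Proof.
case: s A M => A M [a0 Aa0] A0 AM.
  have hs : has_sup A by split; [exists a0|exists M].
  exists (sup A); split; first by move=> x Ax; exact: ub_le_sup (proj2 hs) _ Ax.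
  by move=> y Ay; apply: ge_sup; [exists a0|].
have ImA a : A a -> a = (complex.Re a)%:C%C.
  by move=> Aa; rewrite RRe_real ?ger0_real ?A0.
pose B := [set complex.Re a | a in A].
have hs : has_sup B.
  split; first by exists (complex.Re a0), a0.
  exists (complex.Re M) => _ [a Aa <-].
  by have := AM _ Aa; rewrite lecE => /andP[].
exists (sup B)%:C%C; split => [x Ax|y Ay].
  rewrite (ImA _ Ax) lecR; apply: (ub_le_sup (proj2 hs)); by exists x.
have /andP[/eqP Imy _] : (complex.Im y == complex.Im a0) && (complex.Re a0 <= complex.Re y).
  by rewrite -lecE; exact: Ay.
have Im0 : complex.Im a0 = 0 by rewrite (ImA _ Aa0).
rewrite lecE Imy Im0 eqxx /=; apply: ge_sup; first by exists (complex.Re a0), a0.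
by move=> _ [a Aa <-]; have := Ay _ Aa; rewrite lecE => /andP[].
Qed.

Lemma scalar_ultra_cvg (I : Type) (U : set_system I) (UU : UltraFilter U)
  (f : I -> K) (M : K) : (forall i, `|f i| <= M) -> cvg (f @ U).
Proof.
have main (g : I -> R) (m : R) : (forall i, `|g i| <= m) -> cvg (g @ U).
  move=> gm.
  have gU : UltraFilter (g @ U).
    split; first exact: fmap_proper_filter.
    move=> G GG UG; apply/seteqP; split => // A GA.
    have [UA|UA] := in_ultra_setVsetC (g @^-1` A) UU; first exact: UA.
    have : G (A `&` ~` A) by apply: filterI => //; exact: UG.
    by rewrite setICr => /filter_not_empty.
  have := @segment_compact R (- m) m; rewrite compact_ultra => /(_ _ gU) gc.
  have [|l [_ gl]] := gc; last by apply/cvg_ex; exists l.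
  by apply: (@filterE _ U) => i /=; rewrite in_itv /= -ler_norml.
case: s f M => f M fM; first exact: main fM.
rewrite /scalar_field in f M fM *.
have fb i : `|complex.Re (f i)| <= complex.Re M /\ `|complex.Im (f i)| <= complex.Re M.
  have := fM i; rewrite normc_def lecE => /andP[_ /=] h; split; apply: le_trans h.
    by rewrite -sqrtr_sqr ler_wsqrtr// lerDl sqr_ge0.
  by rewrite -sqrtr_sqr ler_wsqrtr// lerDr sqr_ge0.
have /cvg_ex[/= a fa] := main (@complex.Re R \o f) _ (fun i => (fb i).1).
have /cvg_ex[/= b fb'] := main (@complex.Im R \o f) _ (fun i => (fb i).2).
exact: cvgP (@complex_cvg R (f @ U) _ (Complex a b) fa fb').
Qed.

Lemma scalar_complete (F : set_system K) : ProperFilter F -> cauchy F -> cvg F.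
Proof.
case: s F => F FF Fc; first exact: R_complete.
have nR (x : R) : `|(x%:C)%C| = (`|x|%:C)%C.
  by rewrite normc_def /= expr0n /= addr0 sqrtr_sqr.
have main (g : complex_field R -> R) : (forall x y, (`|g x - g y|%:C)%C <= `|x - y|) ->
    cvg (g @ F).
  move=> gx; apply: R_complete; apply/cauchy_ballP => e e0.
  have /cauchy_ballP /(_ (e%:C)%C) := Fc.
  rewrite ltcR => /(_ e0) [[A B]] /= [FA FB] AB.
  exists (g @` A, g @` B) => /=.
    by split; [apply: filterS FA|apply: filterS FB] => x Ax; exists x.
  move=> [_ _] [/= [x Ax <-] [y By <-]].
  rewrite /ball/= -ltcR; apply: le_lt_trans (gx _ _) _.
  exact: (AB (x, y)).
have /cvg_ex[/= a Fa] : cvg ((@complex.Re R : complex_field R -> R) @ F).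
  apply: main => x y; apply: le_trans (normc_ge_Re _).
  by case: x y => [? ?] [? ?].
have /cvg_ex[/= b Fb] : cvg ((@complex.Im R : complex_field R -> R) @ F).
  apply: main => x y; rewrite normc_def lecR.
  by case: x y => [? ?] [? ?] /=; rewrite -sqrtr_sqr ler_wsqrtr// lerDr sqr_ge0.
exact: cvgP (@complex_cvg R F _ (Complex a b) Fa Fb).
Qed.

End Scalars.

Lemma cvg_norm_le (K : numFieldType) (V : normedModType K) (T : Type)
    (F : set_system T) {FF : ProperFilter F} (g : T -> V) (l : V) (M : K) :
  g @ F --> l -> F [set t | `|g t| <= M] -> `|l| <= M.
Proof.
move=> /cvgrPdist_lt gl gM; apply/ler_addgt0Pl => e /gl le.
have [t [/= lt gt]] := filter_ex (filterI le gM).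
by rewrite -[l](subrK (g t)) (le_trans (ler_normD _ _))// lerD// ltW.
Qed.

Lemma cvg_ge0 (K : numFieldType) (T : Type) (F : set_system T)
    {FF : ProperFilter F} (f : T -> K) (a : K) :
  f @ F --> a -> (forall t, 0 <= f t) -> 0 <= a.
Proof.
move=> fa f0; have h : `|f t| @[t --> F] --> `|a| by exact: (@cvg_norm K K^o).
have -> : a = `|a|; last exact: normr_ge0.
apply: (cvg_unique _ fa); first exact: (@norm_hausdorff K K^o).
by rewrite (_ : f = fun t => `|f t|)//; apply/funext => t; rewrite ger0_norm.
Qed.

Lemma cvg_ler (K : numFieldType) (T : Type) (F : set_system T)
    {FF : ProperFilter F} (f g : T -> K) (a b : K) :
  f @ F --> a -> g @ F --> b -> (forall t, f t <= g t) -> a <= b.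
Proof.
move=> fa gb fg; rewrite -subr_ge0; apply: (@cvg_ge0 K T F _ (g \- f)).
  exact: (@cvgB K K^o).
by move=> t /=; rewrite subr_ge0.
Qed.

Section Dual.
Context {R : realType} {s : scalar_kind}.
Local Notation K := (scalar_field R s).
Variable E : normedModType K.

Definition functional : {pred E -> K^o} :=
  fun f => `[< linear f /\ continuous f >].

Lemma functional_submod_closed : submod_closed functional.
Proof.
split.
  apply/asboolP; split; last exact: cst_continuous.
  by move=> a x y; rewrite scaler0 addr0.
move=> a f g /asboolP[fl fc] /asboolP[gl gc]; apply/asboolP; split.
  move=> b x y; rewrite !fctE fl gl !scalerDr !scalerA (mulrC a) -!addrA.
  by congr (_ + _); rewrite addrCA.
by move=> x; apply: (@cvgD _ _ _ _ _ (a *: f) g); [apply: cvgZl_tmp; exact: fc|exact: gc].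
Qed.

HB.instance Definition _ :=
  GRing.isSubmodClosed.Build K (E -> K^o) functional functional_submod_closed.

Record dual := Dual { dual_fun :> E -> K^o; dual_funP : dual_fun \in functional }.

HB.instance Definition _ := [isSub for dual_fun].
HB.instance Definition _ := [Choice of dual by <:].
HB.instance Definition _ := [SubChoice_isSubLmodule of dual by <:].

Lemma dual_linear (f : dual) : linear f.
Proof. by have /asboolP[] := dual_funP f. Qed.

HB.instance Definition _ (f : dual) :=
  GRing.isLinear.Build K E K^o *:%R (dual_fun f) (dual_linear f).

Lemma dual_continuous (f : dual) : continuous f.
Proof. by have /asboolP[] := dual_funP f. Qed.

Lemma dual_ext (f g : dual) : f =1 g -> f = g.
Proof. by move=> fg; apply/val_inj/funext. Qed.

Lemma dual_addE (f g : dual) x : (f + g) x = f x + g x. Proof. by []. Qed.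
Lemma dual_oppE (f : dual) x : (- f) x = - f x. Proof. by []. Qed.
Lemma dual_scaleE a (f : dual) x : (a *: f) x = a * f x. Proof. by []. Qed.
Lemma dual_zeroE x : (0 : dual) x = 0. Proof. by []. Qed.

(** The order of [R[i]] is partial, but its restriction to the reals is the usual
    one, so this is the usual operator norm in both cases. *)
Definition dual_norm (f : dual) : K :=
  supremum 0 [set `|f x| | x in [set x | `|x| <= 1]].

Lemma dual_bounded (f : dual) : exists2 M, 0 <= M & forall x, `|f x| <= M * `|x|.
Proof.
have /linear_bounded_continuous/linear_boundedP := @dual_continuous f.
by move=> /pinfty_ex_gt0[M M0 fM]; exists M => //; exact: ltW.
Qed.

Lemma dual_supremums (f : dual) :
  supremums [set `|f x| | x in [set x | `|x| <= 1]] !=set0.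
Proof.
have [M M0 fM] := dual_bounded f.
apply: (@scalar_supremums _ _ _ M).
- by exists `|f 0|, 0 => //=; rewrite normr0.
- by move=> _ [x _ <-].
- by move=> _ [x /= x1 <-]; rewrite (le_trans (fM x))// ler_piMr.
Qed.

Lemma dual_norm_supremums (f : dual) :
  supremums [set `|f x| | x in [set x | `|x| <= 1]] (dual_norm f).
Proof.
rewrite /dual_norm /supremum; case: ifPn => [/eqP A0|_].
  have : [set `|f x| | x in [set x | `|x| <= 1]] `|f 0|.
    by exists 0 => //=; rewrite normr0.
  by rewrite A0.
by have [y Ay] := dual_supremums f; case: xgetP => [y' -> //|/(_ y)].
Qed.

Lemma dual_norm_ub (f : dual) x : `|x| <= 1 -> `|f x| <= dual_norm f.
Proof. by move=> x1; apply: (dual_norm_supremums f).1; exists x. Qed.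

Lemma dual_norm_le (f : dual) M : (forall x, `|x| <= 1 -> `|f x| <= M) ->
  dual_norm f <= M.
Proof.
by move=> fM; apply: (dual_norm_supremums f).2 => _ [x /= x1 <-]; exact: fM.
Qed.

Lemma dual_norm_ge0 (f : dual) : 0 <= dual_norm f.
Proof. by apply: le_trans (dual_norm_ub f (x := 0) _); rewrite ?normr0. Qed.

Lemma dual_norm_bound (f : dual) x : `|f x| <= dual_norm f * `|x|.
Proof.
have [->|x0] := eqVneq x 0; first by rewrite linear0 !normr0 mulr0.
rewrite -ler_pdivrMr ?normr_gt0//.
have := @dual_norm_ub f (`|x|^-1 *: x).
rewrite linearZ /= !normrZ normfV normr_id mulVf ?normr_eq0// => /(_ (lexx _)).
by rewrite mulrC.
Qed.

Let dual_normD (f g : dual) : dual_norm (f + g) <= dual_norm f + dual_norm g.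
Proof.
apply: dual_norm_le => x x1; rewrite dual_addE (le_trans (ler_normD _ _))//.
by rewrite lerD// dual_norm_ub.
Qed.

Let dual_normZ a (f : dual) : dual_norm (a *: f) = `|a| * dual_norm f.
Proof.
have le b (g : dual) : dual_norm (b *: g) <= `|b| * dual_norm g.
  by apply: dual_norm_le => x x1; rewrite dual_scaleE normrM ler_wpM2l// dual_norm_ub.
have [->|a0] := eqVneq a 0.
  apply/eqP; rewrite eq_le le scale0r normr0 mul0r; exact: dual_norm_ge0.
apply/eqP; rewrite eq_le le /=.
rewrite -{1}[f]scale1r -(mulVf a0) -scalerA.
by rewrite -ler_pdivlMl ?normr_gt0// -normfV le.
Qed.

Let dual_norm0_eq0 (f : dual) : dual_norm f = 0 -> f = 0.
Proof.
move=> f0; apply: dual_ext => x; apply/eqP; rewrite -normr_eq0 eq_le normr_ge0 andbT.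
by rewrite (le_trans (dual_norm_bound f x))// f0 mul0r.
Qed.

HB.instance Definition _ :=
  Lmodule_isNormed.Build K dual dual_normD dual_normZ dual_norm0_eq0.

Lemma dual_normE (f : dual) :
  `|f| = supremum 0 [set `|f x| | x in [set x | `|x| <= 1]].
Proof. by []. Qed.

Lemma functionalP (f : E -> K^o) (M : K) : 0 <= M ->
  linear f -> (forall x, `|f x| <= M * `|x|) -> f \in functional.
Proof.
move=> M0 fl fM; apply/asboolP; split => //.
pose g : {linear E -> K^o} :=
  HB.pack f (GRing.isLinear.Build K E K^o *:%R f fl).
apply: (@bounded_linear_continuous _ _ _ g); apply/linear_boundedP.
near=> r => x; rewrite (le_trans (fM x))// ler_wpM2r//.
by near: r; apply: nbhs_pinfty_ge; rewrite ger0_real.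
Unshelve. all: by end_near. Qed.

Definition mk_dual (f : E -> K^o) (M : K) (M0 : 0 <= M) (fl : linear f)
    (fM : forall x, `|f x| <= M * `|x|) : dual := Dual (functionalP M0 fl fM).

Lemma mk_dual_norm (f : E -> K^o) (M : K) (M0 : 0 <= M) (fl : linear f)
    (fM : forall x, `|f x| <= M * `|x|) : `|mk_dual M0 fl fM| <= M.
Proof. by apply: dual_norm_le => x x1; rewrite (le_trans (fM x))// ler_piMr. Qed.

Let dual_complete (F : set_system dual) : ProperFilter F -> cauchy F -> cvg F.
Proof.
move=> FF /cauchy_ballP Fc.
have Fx x : cvg ((fun f : dual => f x : K) @ F).
  apply: scalar_complete; apply/cauchy_ballP => e e0.
  have d0 : 0 < e / (`|x| + 1) by rewrite divr_gt0// ltr_wpDl.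
  have [[A B] /= [FA FB] AB] := Fc _ d0.
  exists ((fun f : dual => f x : K) @` A, (fun f : dual => f x : K) @` B) => /=.
    by split; [apply: filterS FA|apply: filterS FB] => f Af; exists f.
  move=> [_ _] [/= [f Af <-] [g Bg <-]].
  have := AB (f, g) (conj Af Bg); rewrite /= -!ball_normE /= => fg.
  have := dual_norm_bound (f - g) x; rewrite dual_addE dual_oppE => /le_lt_trans; apply.
  apply: (@le_lt_trans _ _ (dual_norm (f - g) * (`|x| + 1))).
    by rewrite ler_wpM2l ?dual_norm_ge0// lerDl.
  by rewrite -ltr_pdivlMr// ltr_wpDl.
pose l x : K^o := lim ((fun f : dual => f x : K) @ F).
have close e : 0 < e -> F [set f : dual | forall x, `|f x - l x| <= e * `|x|].
  move=> e0; have [[A B] /= [FA FB] AB] := Fc _ e0.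
  apply: filterS FA => f Af x.
  have h : ((f x : K) - g x @[g --> F]) --> (f x : K) - l x.
    by apply: cvgB; [exact: cvg_cst|exact: Fx].
  apply: (cvg_norm_le h).
  apply: filterS FB => g Bg; have := AB (f, g) (conj Af Bg).
  rewrite /= -ball_normE /= => fg.
  by rewrite (le_trans (dual_norm_bound (f - g) x))// ler_wpM2r// ltW.
have ll : linear l.
  move=> a x y; apply: cvg_lim => //.
  rewrite (_ : (fun f : dual => f (a *: x + y)) = fun f => a * f x + f y); last first.
    by apply/funext => f; rewrite linearD linearZ.
  apply: (@cvgD K K^o); last exact: Fx.
  by apply: (@cvgM K); [exact: cvg_cst|exact: Fx].
have [f0 f0l] := filter_ex (close _ ltr01).
have [M M0 f0M] := dual_bounded f0.
have lM x : `|l x| <= (1 + M) * `|x|.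
  rewrite -[l x](subrK (f0 x)) (le_trans (ler_normD _ _))// mulrDl lerD//.
  by rewrite distrC.
have M10 : 0 <= 1 + M by rewrite addr_ge0.
apply/cvg_ex; exists (mk_dual M10 ll lM); apply/cvgrPdist_le => e e0.
apply: filterS (close _ e0) => f fl; rewrite distrC.
apply: dual_norm_le => x x1; rewrite (le_trans (fl x))//.
by rewrite ler_piMr// ltW.
Qed.

HB.instance Definition _ := Uniform_isComplete.Build dual dual_complete.

End Dual.

(** Algebras need not be unital, hence cannot be MathComp rings. *)

HB.mixin Record NormedModule_isNormedAlgebra (K : numFieldType) A
    of NormedModule K A := {
  amul : A -> A -> A;
  amulA : associative amul;
  amul_linearl : forall b, linear (fun a => amul a b);
  amul_linearr : forall a, linear (amul a);
  amul_norm : forall a b, `|amul a b| <= `|a| * `|b|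
}.

#[short(type="normedAlgType")]
HB.structure Definition NormedAlgebra (K : numFieldType) :=
  {A of NormedModule K A & NormedModule_isNormedAlgebra K A}.

#[short(type="banachAlgType")]
HB.structure Definition BanachAlgebra (K : numFieldType) :=
  {A of NormedAlgebra K A & Complete A}.

Section NormedAlgebraTheory.
Variables (K : numFieldType) (A : normedAlgType K).
Implicit Types a b c : A.

Lemma amulBl a b c : amul (a - b) c = amul a c - amul b c.
Proof. by rewrite addrC -scaleN1r amul_linearl scaleN1r addrC. Qed.

Lemma amulBr a b c : amul a (b - c) = amul a b - amul a c.
Proof. by rewrite addrC -scaleN1r amul_linearr scaleN1r addrC. Qed.

End NormedAlgebraTheory.

Section Arens.
Context {R : realType} {s : scalar_kind}.
Local Notation K := (scalar_field R s).
Variable A : normedAlgType K.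
Implicit Types (a b : A) (mu : dual A) (F G : dual (dual A)).

(** [lact a mu] is $a\cdot\mu$ and [ract mu a] is $\mu\cdot a$. *)

Let lact_linear a mu : linear (fun b => mu (amul b a) : K^o).
Proof. by move=> k b c; rewrite amul_linearl linearP. Qed.

Let lact_bound a mu b : `|mu (amul b a)| <= (`|mu| * `|a|) * `|b|.
Proof.
rewrite (le_trans (dual_norm_bound mu _))// -mulrA ler_wpM2l ?dual_norm_ge0//.
by rewrite mulrC amul_norm.
Qed.

Definition lact a mu : dual A :=
  mk_dual (mulr_ge0 (normr_ge0 mu) (normr_ge0 a)) (lact_linear a mu)
    (lact_bound a mu).

Let ract_linear mu a : linear (fun b => mu (amul a b) : K^o).
Proof. by move=> k b c; rewrite amul_linearr linearP. Qed.

Let ract_bound mu a b : `|mu (amul a b)| <= (`|mu| * `|a|) * `|b|.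
Proof.
rewrite (le_trans (dual_norm_bound mu _))// -mulrA ler_wpM2l ?dual_norm_ge0//.
by rewrite amul_norm.
Qed.

Definition ract mu a : dual A :=
  mk_dual (mulr_ge0 (normr_ge0 mu) (normr_ge0 a)) (ract_linear mu a)
    (ract_bound mu a).

Lemma lactE a mu b : lact a mu b = mu (amul b a). Proof. by []. Qed.
Lemma ractE mu a b : ract mu a b = mu (amul a b). Proof. by []. Qed.

(** The Arens products are defined from the actions of the bidual on the dual
    $\langle G\cdot\mu,a\rangle=\langle G,\mu\cdot a\rangle$ and
    $\langle\mu\cdot F,a\rangle=\langle F,a\cdot\mu\rangle$. *)

Let bilact_linear G mu : linear (fun a => G (ract mu a) : K^o).
Proof.
move=> k a b; rewrite -linearP; congr (G _); apply: dual_ext => c.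
by rewrite dual_addE dual_scaleE !ractE amul_linearl linearP.
Qed.

Let bilact_bound G mu a : `|G (ract mu a)| <= (`|G| * `|mu|) * `|a|.
Proof.
rewrite (le_trans (dual_norm_bound G _))// -mulrA ler_wpM2l ?dual_norm_ge0//.
exact: mk_dual_norm.
Qed.

Definition bilact G mu : dual A :=
  mk_dual (mulr_ge0 (normr_ge0 G) (normr_ge0 mu)) (bilact_linear G mu)
    (bilact_bound G mu).

Let biract_linear mu F : linear (fun a => F (lact a mu) : K^o).
Proof.
move=> k a b; rewrite -linearP; congr (F _); apply: dual_ext => c.
by rewrite dual_addE dual_scaleE !lactE amul_linearr linearP.
Qed.

Let biract_bound mu F a : `|F (lact a mu)| <= (`|F| * `|mu|) * `|a|.
Proof.
rewrite (le_trans (dual_norm_bound F _))// -mulrA ler_wpM2l ?dual_norm_ge0//.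
exact: mk_dual_norm.
Qed.

Definition biract mu F : dual A :=
  mk_dual (mulr_ge0 (normr_ge0 F) (normr_ge0 mu)) (biract_linear mu F)
    (biract_bound mu F).

Lemma bilactE G mu a : bilact G mu a = G (ract mu a). Proof. by []. Qed.
Lemma biractE mu F a : biract mu F a = F (lact a mu). Proof. by []. Qed.

Let arens1_linear F G : linear (fun mu => F (bilact G mu) : K^o).
Proof.
move=> k mu nu; rewrite -linearP; congr (F _); apply: dual_ext => a.
rewrite dual_addE dual_scaleE !bilactE.
have -> : ract (k *: mu + nu) a = k *: ract mu a + ract nu a by apply: dual_ext.
exact: linearP.
Qed.

Let arens1_bound F G mu : `|F (bilact G mu)| <= (`|F| * `|G|) * `|mu|.
Proof.
rewrite (le_trans (dual_norm_bound F _))// -mulrA ler_wpM2l ?dual_norm_ge0//.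
exact: mk_dual_norm.
Qed.

Definition arens1 F G : dual (dual A) :=
  mk_dual (mulr_ge0 (normr_ge0 F) (normr_ge0 G)) (arens1_linear F G)
    (arens1_bound F G).

Let arens2_linear F G : linear (fun mu => G (biract mu F) : K^o).
Proof.
move=> k mu nu; rewrite -linearP; congr (G _); apply: dual_ext => a.
rewrite dual_addE dual_scaleE !biractE.
have -> : lact a (k *: mu + nu) = k *: lact a mu + lact a nu by apply: dual_ext.
exact: linearP.
Qed.

Let arens2_bound F G mu : `|G (biract mu F)| <= (`|F| * `|G|) * `|mu|.
Proof.
rewrite (le_trans (dual_norm_bound G _))// [`|F| * _]mulrC -mulrA.
by rewrite ler_wpM2l ?dual_norm_ge0//; exact: mk_dual_norm.
Qed.

Definition arens2 F G : dual (dual A) :=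
  mk_dual (mulr_ge0 (normr_ge0 F) (normr_ge0 G)) (arens2_linear F G)
    (arens2_bound F G).

Lemma arens1E F G mu : arens1 F G mu = F (bilact G mu). Proof. by []. Qed.
Lemma arens2E F G mu : arens2 F G mu = G (biract mu F). Proof. by []. Qed.

Definition arens_regular : Prop := forall F G, arens1 F G = arens2 F G.

Definition bidual : Type := dual (dual A).

HB.instance Definition _ := CompleteNormedModule.on bidual.

Let arens1A : associative (arens1 : bidual -> bidual -> bidual).
Proof.
move=> F G H; apply: dual_ext => mu; rewrite !arens1E; congr (F _).
apply: dual_ext => a; rewrite !bilactE arens1E; congr (G _).
apply: dual_ext => b; rewrite ractE !bilactE; congr (H _).
by apply: dual_ext => c; rewrite !ractE amulA.
Qed.

Let arens1_linearl (G : bidual) : linear (fun F : bidual => arens1 F G : bidual).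
Proof. by move=> k F H; apply: dual_ext. Qed.

Let arens1_linearr (F : bidual) : linear (arens1 F : bidual -> bidual).
Proof.
move=> k G H; apply: dual_ext => mu; rewrite dual_addE dual_scaleE !arens1E.
rewrite -linearP; congr (F _).
by apply: dual_ext => a; rewrite dual_addE dual_scaleE !bilactE.
Qed.

Let arens1_norm (F G : bidual) : `|arens1 F G : bidual| <= `|F| * `|G|.
Proof. exact: mk_dual_norm. Qed.

(** The bidual always carries the first Arens product; when the algebra is
    Arens regular, this is the common value of the two Arens products. *)
HB.instance Definition _ := NormedModule_isNormedAlgebra.Build K bidual
  arens1A arens1_linearl arens1_linearr arens1_norm.

End Arens.

Section WeaklyCompact.
Context {R : realType} {s : scalar_kind}.
Local Notation K := (scalar_field R s).

Definition weak_space (E : normedModType K) : Type :=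
  initial_topology (fun x : E => (fun f => f x) : {ptws dual E -> K^o}).

HB.instance Definition _ (E : normedModType K) := Topological.on (weak_space E).

(** [weak_space E] is [E] with the topology $\sigma(E,E')$; [precompact] means
    that the closure is compact. *)
Definition weakly_compact (E F : normedModType K) (T : E -> F) : Prop :=
  precompact (T @` [set x | `|x| <= 1] : set (weak_space F)).

Definition wap (A : normedAlgType K) : set (dual A) :=
  [set mu | weakly_compact (fun a => lact a mu)].

(** [even_dual A n] is the dual of order [2 * n] of [A]. When the even duals of
    lower order are Arens regular, its product is the iterated common Arens
    product. *)
Fixpoint even_dual (A : banachAlgType K) (n : nat) : banachAlgType K :=
  if n is m.+1 then bidual (even_dual A m) else A.

End WeaklyCompact.

Arguments wap {R s} A.

Section DualBanachAlgebra.
Context {R : realType} {s : scalar_kind}.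
Local Notation K := (scalar_field R s).

Definition weakstar_space (A : choiceType) (X : normedModType K)
    (j : A -> dual X) : Type :=
  initial_topology (fun a : A => (fun x => j a x) : {ptws X -> K^o}).

HB.instance Definition _ (A : choiceType) (X : normedModType K)
  (j : A -> dual X) := Topological.on (weakstar_space j).

End DualBanachAlgebra.

(** The algebra is the dual of [predual] through the isometric isomorphism
    [to_dual]. *)
Record dualBanachAlgebra (R : realType) (s : scalar_kind) := {
  dba_alg :> banachAlgType (scalar_field R s);
  predual : completeNormedModType (scalar_field R s);
  to_dual : {linear dba_alg -> dual predual};
  to_dual_norm : forall a, `|to_dual a| = `|a|;
  to_dual_surj : forall f, exists a, to_dual a = f;
  dba_contl : forall a, continuous ((fun b => amul b a) :
    weakstar_space to_dual -> weakstar_space to_dual);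
  dba_contr : forall a, continuous ((fun b => amul a b) :
    weakstar_space to_dual -> weakstar_space to_dual)
}.

Record ultrafilter (I : Type) := Ultrafilter {
  ultra_sets :> set_system I;
  ultra_filter : UltraFilter ultra_sets
}.
#[global] Existing Instance ultra_filter.

Section BoundedFamilies.
Context {R : realType} {s : scalar_kind}.
Local Notation K := (scalar_field R s).
Variables (E : normedModType K) (I : Type).

Definition bounded_family : {pred I -> E} :=
  fun x => `[< exists M : K, forall i, `|x i| <= M >].

Lemma bounded_family_submod_closed : submod_closed bounded_family.
Proof.
split; first by apply/asboolP; exists 0 => i; rewrite normr0.
move=> a x y /asboolP[M xM] /asboolP[N yN]; apply/asboolP.
exists (`|a| * M + N) => i.
by rewrite (le_trans (ler_normD _ _))// lerD// normrZ ler_wpM2l.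
Qed.

HB.instance Definition _ :=
  GRing.isSubmodClosed.Build K (I -> E) bounded_family bounded_family_submod_closed.

Record linfty := Linfty {
  linfty_fun :> I -> E;
  linftyP : linfty_fun \in bounded_family
}.

HB.instance Definition _ := [isSub for linfty_fun].
HB.instance Definition _ := [Choice of linfty by <:].
HB.instance Definition _ := [SubChoice_isSubLmodule of linfty by <:].

Lemma linfty_bounded (x : linfty) : exists2 M, 0 <= M & forall i, `|x i| <= M.
Proof.
have /asboolP[M xM] := linftyP x.
have [[k _]|nI] := pselect (exists i : I, True).
  by exists M => //; apply: le_trans (xM k).
by exists 0 => // i; exfalso; apply: nI; exists i.
Qed.

Lemma linfty_addE (x y : linfty) i : (x + y) i = x i + y i. Proof. by []. Qed.
Lemma linfty_oppE (x : linfty) i : (- x) i = - x i. Proof. by []. Qed.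
Lemma linfty_scaleE a (x : linfty) i : (a *: x) i = a *: x i. Proof. by []. Qed.

End BoundedFamilies.

Section Ultrapower.
Context {R : realType} {s : scalar_kind}.
Local Notation K := (scalar_field R s).
Variables (I : Type) (U : ultrafilter I) (E : normedModType K).
Local Open Scope quotient_scope.

Definition ultra_null : {pred linfty E I} :=
  fun x => `[< `|x i| @[i --> ultra_sets U] --> (0 : K) >].

Lemma ultra_nullP (x : linfty E I) : reflect (x i @[i --> ultra_sets U] --> 0) (x \in ultra_null).
Proof. by apply: (iffP (asboolP _)) => [/norm_cvg0//|h]; rewrite -(normr0 E); exact: cvg_norm. Qed.

Lemma ultra_nullZ a (x : linfty E I) : x \in ultra_null -> a *: x \in ultra_null.
Proof.
by move=> /ultra_nullP x0; apply/ultra_nullP; rewrite -(scaler0 _ a); exact: cvgZl_tmp.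
Qed.

Lemma ultra_null_zmod_closed : zmod_closed ultra_null.
Proof.
split; first by apply/ultra_nullP; exact: cvg_cst.
move=> x y /ultra_nullP x0 /ultra_nullP y0; apply/ultra_nullP.
by rewrite -[0](subr0 0); exact: cvgB.
Qed.

HB.instance Definition _ :=
  GRing.isZmodClosed.Build (linfty E I) ultra_null ultra_null_zmod_closed.

(** [ultra_null] is the subspace $\{x : \lim_U\|x_i\|=0\}$ of [linfty E I]. *)
Definition ultrapower : Type := Quotient.quot ultra_null.

HB.instance Definition _ := GRing.Zmodule.on ultrapower.
HB.instance Definition _ := Quotient.on ultrapower.

Lemma ultra_eqP (x y : linfty E I) :
  reflect (x i - y i @[i --> ultra_sets U] --> 0) (x == y %[mod ultrapower]).
Proof. by rewrite -[_ == _]Quotient.idealrBE; exact: (@ultra_nullP (x - y)). Qed.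

Lemma ultra_piD (x y : linfty E I) :
  \pi_ultrapower (x + y) = \pi_ultrapower x + \pi_ultrapower y.
Proof. by rewrite !piE. Qed.

Lemma ultra_piK (q : ultrapower) : \pi_ultrapower (repr q) = q.
Proof. exact: reprK. Qed.

Definition ultra_scale a (q : ultrapower) : ultrapower := \pi_ultrapower (a *: repr q).

Lemma ultra_scale_pi a x : ultra_scale a (\pi_ultrapower x) = \pi_ultrapower (a *: x).
Proof.
apply/eqP; rewrite -[_ == _]Quotient.idealrBE -scalerBr ultra_nullZ//.
by rewrite Quotient.idealrBE; exact/eqP/ultra_piK.
Qed.

Let ultra_scaleA a b q : ultra_scale a (ultra_scale b q) = ultra_scale (a * b) q.
Proof. by rewrite -[q]ultra_piK !ultra_scale_pi scalerA. Qed.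

Let ultra_scale1 : left_id 1 ultra_scale.
Proof. by move=> q; rewrite -[q]ultra_piK !ultra_scale_pi scale1r. Qed.

Let ultra_scaleDr : right_distributive ultra_scale +%R.
Proof.
move=> a p q; rewrite -[p]ultra_piK -[q]ultra_piK -ultra_piD !ultra_scale_pi.
by rewrite scalerDr ultra_piD.
Qed.

Let ultra_scaleDl q : {morph ultra_scale^~ q : a b / a + b}.
Proof.
by move=> a b; rewrite -[q]ultra_piK !ultra_scale_pi scalerDl ultra_piD.
Qed.

HB.instance Definition _ := GRing.Zmodule_isLmodule.Build K ultrapower
  ultra_scaleA ultra_scale1 ultra_scaleDr ultra_scaleDl.

Lemma linfty_norm_cvg (x : linfty E I) : cvg (`|x i| @[i --> ultra_sets U]).
Proof.
have [M _ xM] := linfty_bounded x; apply: (@scalar_ultra_cvg _ _ _ _ _ _ M).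
by move=> i; rewrite normr_id.
Qed.

Definition ultra_norm (q : ultrapower) : K := lim (`|repr q i| @[i --> ultra_sets U]).

Lemma ultra_norm_pi (x : linfty E I) : ultra_norm (\pi_ultrapower x) = lim (`|x i| @[i --> ultra_sets U]).
Proof.
have /eqP/ultra_eqP h := ultra_piK (\pi_ultrapower x).
apply: cvg_lim => //.
have -> : lim (`|x i| @[i --> ultra_sets U]) = 0 + lim (`|x i| @[i --> ultra_sets U]) by rewrite add0r.
rewrite (_ : (fun i => _) =
  fun i => (`|repr (\pi_ultrapower x) i| - `|x i|) + `|x i|); last first.
  by apply/funext => i; rewrite subrK.
apply: cvgD; last exact: linfty_norm_cvg.
apply/cvgr0Pnorm_lt => e e0; move/cvgr0Pnorm_lt : h => /(_ _ e0).
by apply: filterS => i; exact: le_lt_trans (ler_dist_dist _ _).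
Qed.

Lemma ultra_norm_cvg (x : linfty E I) :
  `|x i| @[i --> ultra_sets U] --> ultra_norm (\pi_ultrapower x).
Proof. by rewrite ultra_norm_pi; exact: linfty_norm_cvg. Qed.

Let ultra_normD p q : ultra_norm (p + q) <= ultra_norm p + ultra_norm q.
Proof.
rewrite -[p]ultra_piK -[q]ultra_piK -ultra_piD.
have h : `|repr p i| + `|repr q i| @[i --> ultra_sets U] -->
    ultra_norm (\pi_ultrapower (repr p)) + ultra_norm (\pi_ultrapower (repr q)).
  by apply: (@cvgD K K^o); exact: ultra_norm_cvg.
exact: (cvg_ler (@ultra_norm_cvg (repr p + repr q)) h (fun i => ler_normD _ _)).
Qed.

Let ultra_normZ a q : ultra_norm (a *: q) = `|a| * ultra_norm q.
Proof.
rewrite -[q]ultra_piK [a *: _]ultra_scale_pi ultra_norm_pi.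
apply: cvg_lim => //; rewrite (_ : (fun i => _) = fun i => `|a| * `|repr q i|).
  apply: (@cvgM K); [exact: cvg_cst|exact: ultra_norm_cvg].
by apply/funext => i; rewrite normrZ.
Qed.

Let ultra_norm0_eq0 q : ultra_norm q = 0 -> q = 0.
Proof.
rewrite -[q]ultra_piK => q0; have := @ultra_norm_cvg (repr q).
rewrite q0 => /norm_cvg0 h; apply/eqP.
have -> : 0 = \pi_ultrapower 0 by rewrite piE.
by apply/ultra_eqP; under eq_fun do rewrite subr0.
Qed.

HB.instance Definition _ :=
  Lmodule_isNormed.Build K ultrapower ultra_normD ultra_normZ ultra_norm0_eq0.

Lemma ultrapower_normE (x : linfty E I) :
  `|\pi_ultrapower x : ultrapower| = lim (`|x i| @[i --> ultra_sets U]).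
Proof. exact: ultra_norm_pi. Qed.

Lemma ultra_piZ a (x : linfty E I) :
  \pi_ultrapower (a *: x) = a *: (\pi_ultrapower x : ultrapower).
Proof. by rewrite -ultra_scale_pi. Qed.

End Ultrapower.

Section UltrapowerAlgebra.
Context {R : realType} {s : scalar_kind}.
Local Notation K := (scalar_field R s).
Variables (I : Type) (U : ultrafilter I) (A : normedAlgType K).
Local Open Scope quotient_scope.
Local Notation AU := (ultrapower U A).

Let linfty_mul_bounded (x y : linfty A I) :
  (fun i => amul (x i) (y i)) \in @bounded_family R s A I.
Proof.
have [M M0 xM] := linfty_bounded x; have [N N0 yN] := linfty_bounded y.
apply/asboolP; exists (M * N) => i.
by rewrite (le_trans (amul_norm _ _))// ler_pM.
Qed.

Definition linfty_mul (x y : linfty A I) : linfty A I :=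
  Linfty (linfty_mul_bounded x y).

Let null_mull (x y : linfty A I) :
  x \in @ultra_null R s I U A -> linfty_mul x y \in @ultra_null R s I U A.
Proof.
have [M M0 yM] := linfty_bounded y.
have M1 : 0 < M + 1 by rewrite ltr_wpDl.
move=> /ultra_nullP/cvgr0Pnorm_lt x0.
apply/ultra_nullP/cvgr0Pnorm_lt => e e0.
have /x0 : 0 < e / (M + 1) by rewrite divr_gt0.
apply: filterS => i xe; rewrite (le_lt_trans (amul_norm _ _))//.
rewrite ltr_pdivlMr// in xe; apply: le_lt_trans xe.
by rewrite ler_wpM2l// (le_trans (yM i))// lerDl.
Qed.

Let null_mulr (x y : linfty A I) :
  y \in @ultra_null R s I U A -> linfty_mul x y \in @ultra_null R s I U A.
Proof.
have [M M0 xM] := linfty_bounded x.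
have M1 : 0 < M + 1 by rewrite ltr_wpDl.
move=> /ultra_nullP/cvgr0Pnorm_lt y0.
apply/ultra_nullP/cvgr0Pnorm_lt => e e0.
have /y0 : 0 < e / (M + 1) by rewrite divr_gt0.
apply: filterS => i ye; rewrite (le_lt_trans (amul_norm _ _))//.
rewrite ltr_pdivlMr// mulrC in ye; apply: le_lt_trans ye.
by rewrite ler_wpM2r// (le_trans (xM i))// lerDl.
Qed.

Definition ultra_mul (p q : AU) : AU := \pi_AU (linfty_mul (repr p) (repr q)).

Lemma ultra_mul_pi (x y : linfty A I) :
  ultra_mul (\pi_AU x) (\pi_AU y) = \pi_AU (linfty_mul x y).
Proof.
apply/eqP; rewrite -[_ == _]Quotient.idealrBE.
set x' := repr _; set y' := repr _.
have -> : linfty_mul x' y' - linfty_mul x y =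
    linfty_mul (x' - x) y' + linfty_mul x (y' - y).
  apply/val_inj/funext => i; rewrite /= !fctE /=.
  by rewrite amulBl amulBr addrA subrK.
apply: rpredD; [apply: null_mull|apply: null_mulr].
  by rewrite Quotient.idealrBE; exact/eqP/ultra_piK.
by rewrite Quotient.idealrBE; exact/eqP/ultra_piK.
Qed.

Let ultra_mulA : associative ultra_mul.
Proof.
move=> p q r; rewrite -[p]ultra_piK -[q]ultra_piK -[r]ultra_piK !ultra_mul_pi.
by congr (\pi_AU _); apply/val_inj/funext => i; exact: amulA.
Qed.

Let ultra_mul_linearl q : linear (fun p => ultra_mul p q).
Proof.
move=> a p r; rewrite -[p]ultra_piK -[q]ultra_piK -[r]ultra_piK.
rewrite -ultra_piZ -ultra_piD !ultra_mul_pi -ultra_piZ -ultra_piD.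
by congr (\pi_AU _); apply/val_inj/funext => i; exact: amul_linearl.
Qed.

Let ultra_mul_linearr p : linear (ultra_mul p).
Proof.
move=> a q r; rewrite -[p]ultra_piK -[q]ultra_piK -[r]ultra_piK.
rewrite -ultra_piZ -ultra_piD !ultra_mul_pi -ultra_piZ -ultra_piD.
by congr (\pi_AU _); apply/val_inj/funext => i; exact: amul_linearr.
Qed.

Let ultra_mul_norm p q : `|ultra_mul p q| <= `|p| * `|q|.
Proof.
rewrite -[p]ultra_piK -[q]ultra_piK ultra_mul_pi.
have h : `|repr p i| * `|repr q i| @[i --> ultra_sets U] -->
    `|\pi_AU (repr p) : AU| * `|\pi_AU (repr q) : AU|.
  by apply: (@cvgM K); exact: ultra_norm_cvg.
exact: (cvg_ler (@ultra_norm_cvg _ _ _ _ _ (linfty_mul (repr p) (repr q))) h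
  (fun i => amul_norm _ _)).
Qed.

(** Completeness of the ultrapower is not needed to define its dual and [wap]. *)
HB.instance Definition _ := NormedModule_isNormedAlgebra.Build K AU
  ultra_mulA ultra_mul_linearl ultra_mul_linearr ultra_mul_norm.

End UltrapowerAlgebra.

Section UltrapowerPairing.
Context {R : realType} {s : scalar_kind}.
Local Notation K := (scalar_field R s).
Variables (A : dualBanachAlgebra R s) (I : Type) (U : ultrafilter I).
Local Open Scope quotient_scope.
Local Notation AU := (ultrapower U A).
Local Notation XU := (ultrapower U (predual A)).
Local Notation "<< a , m >>" := (@to_dual R s A a m : K).

Let pairing_bound (a : A) (m : predual A) : `|<< a, m >>| <= `|a| * `|m|.
Proof. by rewrite -to_dual_norm; exact: dual_norm_bound. Qed.

Lemma ultra_pairing_cvg (a : linfty A I) (m : linfty (predual A) I) :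
  cvg (<< a i, m i >> @[i --> ultra_sets U]).
Proof.
have [M M0 aM] := linfty_bounded a; have [N N0 mN] := linfty_bounded m.
apply: (@scalar_ultra_cvg _ _ _ _ _ _ (M * N)) => i.
by rewrite (le_trans (pairing_bound _ _))// ler_pM.
Qed.

Definition ultra_pairing_fun (m : XU) (a : AU) : K^o :=
  lim (<< repr a i, repr m i >> @[i --> ultra_sets U]).

Let null_pairing (a : linfty A I) (m : linfty (predual A) I) :
  a \in @ultra_null R s I U A \/ m \in @ultra_null R s I U (predual A) ->
  << a i, m i >> @[i --> ultra_sets U] --> (0 : K).
Proof.
have [M M0 aM] := linfty_bounded a; have [N N0 mN] := linfty_bounded m.
have M1 : 0 < M + 1 by rewrite ltr_wpDl.
have N1 : 0 < N + 1 by rewrite ltr_wpDl.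
case=> /ultra_nullP/cvgr0Pnorm_lt h; apply/cvgr0Pnorm_lt => e e0.
  have /h : 0 < e / (N + 1) by rewrite divr_gt0.
  apply: filterS => i ie; rewrite (le_lt_trans (pairing_bound _ _))//.
  rewrite ltr_pdivlMr// in ie; apply: le_lt_trans ie.
  by rewrite ler_wpM2l// (le_trans (mN i))// lerDl.
have /h : 0 < e / (M + 1) by rewrite divr_gt0.
apply: filterS => i ie; rewrite (le_lt_trans (pairing_bound _ _))//.
rewrite ltr_pdivlMr// mulrC in ie; apply: le_lt_trans ie.
by rewrite ler_wpM2r// (le_trans (aM i))// lerDl.
Qed.

Lemma ultra_pairing_fun_pi (m : linfty (predual A) I) (a : linfty A I) :
  ultra_pairing_fun (\pi_XU m) (\pi_AU a) =
  lim (<< a i, m i >> @[i --> ultra_sets U]).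
Proof.
have ha : repr (\pi_AU a) - a \in @ultra_null R s I U A.
  by rewrite Quotient.idealrBE; exact/eqP/ultra_piK.
have hm : repr (\pi_XU m) - m \in @ultra_null R s I U (predual A).
  by rewrite Quotient.idealrBE; exact/eqP/ultra_piK.
rewrite /ultra_pairing_fun; set a' := repr _ in ha *; set m' := repr _ in hm *.
apply: cvg_lim => //.
have h1 := null_pairing (m := m') (or_introl ha).
have h2 := null_pairing (a := a) (or_intror hm).
have h3 := cvgD (cvgD h1 h2) (@ultra_pairing_cvg a m).
rewrite !add0r in h3; rewrite (_ : (fun i => _) =
    (fun i => << (a' - a) i, m' i >>) \+ (fun i => << a i, (m' - m) i >>) \+
    (fun i => << a i, m i >>)); first exact: h3.
apply/funext => i.
transitivity (<< a' i - a i, m' i >> + << a i, m' i - m i >> + << a i, m i >>) => //.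
by rewrite !linearB dual_addE dual_oppE addrA subrK subrK.
Qed.

Lemma ultra_pairing_fun_cvg (m : linfty (predual A) I) (a : linfty A I) :
  << a i, m i >> @[i --> ultra_sets U] -->
  (ultra_pairing_fun (\pi_XU m) (\pi_AU a) : K).
Proof. by rewrite ultra_pairing_fun_pi; exact: ultra_pairing_cvg. Qed.

Let ultra_pairing_linear m : linear (ultra_pairing_fun m).
Proof.
move=> k a b; rewrite -[m]ultra_piK -[a]ultra_piK -[b]ultra_piK.
rewrite -ultra_piZ -ultra_piD ultra_pairing_fun_pi.
apply: cvg_lim => //.
have h : k * << repr a i, repr m i >> + << repr b i, repr m i >>
    @[i --> ultra_sets U] -->
    k * ultra_pairing_fun (\pi_XU (repr m)) (\pi_AU (repr a)) +
    ultra_pairing_fun (\pi_XU (repr m)) (\pi_AU (repr b)).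
  apply: (@cvgD K K^o); last exact: ultra_pairing_fun_cvg.
  by apply: (@cvgM K); [exact: cvg_cst|exact: ultra_pairing_fun_cvg].
rewrite (_ : (fun i => _) = fun i =>
    k * << repr a i, repr m i >> + << repr b i, repr m i >>); first exact: h.
by apply/funext => i; rewrite linfty_addE linfty_scaleE linearP dual_addE dual_scaleE.
Qed.

Let ultra_pairing_bound m a : `|ultra_pairing_fun m a| <= `|m| * `|a|.
Proof.
rewrite -[m]ultra_piK -[a]ultra_piK.
have h1 : `|<< repr a i, repr m i >>| @[i --> ultra_sets U] -->
    `|ultra_pairing_fun (\pi_XU (repr m)) (\pi_AU (repr a))|.
  by apply: (@cvg_norm K K^o); exact: ultra_pairing_fun_cvg.
have h2 : `|repr m i| * `|repr a i| @[i --> ultra_sets U] -->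
    `|\pi_XU (repr m) : XU| * `|\pi_AU (repr a) : AU|.
  by apply: (@cvgM K); exact: ultra_norm_cvg.
by apply: (cvg_ler h1 h2) => i; rewrite mulrC; exact: pairing_bound.
Qed.

Definition ultra_pairing (m : XU) : dual AU :=
  mk_dual (normr_ge0 m) (@ultra_pairing_linear m) (@ultra_pairing_bound m).

Lemma ultra_pairingE (m : linfty (predual A) I) (a : linfty A I) :
  ultra_pairing (\pi_XU m) (\pi_AU a) =
  lim (<< a i, m i >> @[i --> ultra_sets U]).
Proof. exact: ultra_pairing_fun_pi. Qed.

End UltrapowerPairing.

(* Main.v *)
(** If the Arens products of [F], [G] differ at [mu], approximating [F] and [G]
    alternately by elements of the algebra (Goldstine's theorem) gives, for any
    [n] and [e], elements [a_i], [b_j] ([i, j < n]) of the unit ball, up to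
    scaling, such that [mu (a_i b_j)] is within [e] of [al] for [i <= j] and of
    [be] for [j < i], where [al], [be] are the two values. Such a half-graph
    involves finitely many conditions, so Goldstine's theorem moves it from a
    bidual [B''] and its dual down to [B] and [B'], and finally from the pairing
    of [A] with [A'] to that of [A] with its predual. Putting these finite
    half-graphs together in an ultrapower over the natural numbers gives an
    infinite one for some element of the ultrapower of the predual; by the double
    limit criterion that element is not in [WAP]. *)

Require Import Defs.
From mathcomp Require Import all_boot all_order all_algebra.
From mathcomp Require Import complex ring.
From mathcomp Require Import all_classical all_reals.
From mathcomp Require Import topology normedtype.

Set Implicit Arguments.
Unset Strict Implicit.
Unset Printing Implicit Defensive.

Import Order.TTheory GRing.Theory Num.Theory.
Import numFieldNormedType.Exports.

Local Open Scope classical_set_scope.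
Local Open Scope ring_scope.

(** * Goldstine's theorem over both scalar fields *)

Section Goldstine.
Context {R : realType} {s : scalar_kind}.
Local Notation K := (scalar_field R s).

(** Taken as the supremum of the nonnegative lower bounds. Since the order of the complex numbers is
    partial, nonnegativity is what makes [d + e] comparable with the elements of [A]. *)
Lemma scalar_infimum (A : set K) : A !=set0 -> (forall a, A a -> 0 <= a) ->
  exists2 d, (forall a, A a -> d <= a) &
    forall e, 0 < e -> exists2 a, A a & a < d + e.
Proof.
move=> [a0 Aa0] A0.
have [|||d [dub dlub]] := @scalar_supremums R s
    [set b | 0 <= b /\ forall a, A a -> b <= a] a0.
- by exists 0; split.
- by move=> b [].
- by move=> b [_]; exact.
have d0 : 0 <= d by apply: dub; split.
have dle a : A a -> d <= a by move=> Aa; apply: dlub => b [_]; exact.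
exists d => // e e0; apply: contrapT => h.
have : d + e <= d.
  apply: dub; split; first by rewrite addr_ge0// ltW.
  move=> a Aa; have de0 : 0 <= d + e by rewrite addr_ge0// ltW.
  rewrite real_leNgt ?ger0_real//; last exact: A0.
  by apply/negP => ad; apply: h; exists a.
by rewrite gerDl => /(lt_le_trans e0); rewrite ltxx.
Qed.

(** The identity or complex conjugation: one argument then serves both fields, with [z + c z] as
    twice the real part. *)
Lemma scalar_conj : exists c : {rmorphism K -> K}, [/\ involutive c,
  (forall z, c z * z = `|z| ^+ 2) & (forall z, z + c z <= 2 * `|z|)].
Proof.
case: s.
  exists (@idfun R : {rmorphism R -> R}); split => z //=.
    by rewrite -expr2 real_normK// num_real.
  by rewrite mulrDl mul1r lerD// ler_norm.
exists (@Num.conj R[i]%C : {rmorphism R[i]%C -> R[i]%C}); split => z /=.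
  - exact: (@conjCK R[i]%C).
  - by rewrite mulrC; symmetry; exact: (@normCK R[i]%C z).
by have := (@leif_Re_Creal R[i]%C z).1; rewrite ReE ler_pdivrMr// mulrC.
Qed.

Lemma dual_sumE (X : normedModType K) (I : Type) (l : seq I) (a : I -> K)
    (f : I -> dual X) x :
  (\sum_(i <- l) a i *: f i) x = \sum_(i <- l) a i * f i x.
Proof.
by apply: (big_rec2 (fun (g : dual X) b => g x = b)) => // i b g _ <-.
Qed.

(** [C = {(f x)_(f <- l) : |x| <= 1}] is convex. At a near-closest point of [C]
    to [(F f)_(f <- l)], the residual defines a functional [g] on [X], and
    [|F g| > |g|] unless the distance is zero. *)
Lemma goldstine (X : normedModType K) (F : dual (dual X)) (l : seq (dual X))
    (e : K) : `|F| <= 1 -> 0 < e ->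
  exists2 x, `|x| <= 1 & forall f, f \in l -> `|F f - f x| < e.
Proof.
move=> F1 e0; apply: contrapT => none.
have [c [cK cN cRe]] := scalar_conj.
have c_ge0 (t : K) : 0 <= t -> c t = t.
  move=> t0; have [->|tN0] := eqVneq t 0; first exact: rmorph0.
  by apply: (mulIf tN0); rewrite cN ger0_norm// expr2.
pose phi x := \sum_(f <- l) `|F f - f x| ^+ 2.
have phi0 x : 0 <= phi x by apply: sumr_ge0 => f _; rewrite exprn_ge0.
have phie x : `|x| <= 1 -> e ^+ 2 <= phi x.
  move=> x1; rewrite real_leNgt ?ger0_real//; last by rewrite exprn_ge0// ltW.
  apply/negP => phix; apply: none; exists x => // f fl.
  rewrite -(ltr_pXn2r (n := 2)) ?nnegrE ?(ltW e0)//.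
  apply: le_lt_trans phix; rewrite /phi (big_rem f)//= lerDl.
  by apply: sumr_ge0 => g _; rewrite exprn_ge0.
have [||d dphi phid] := @scalar_infimum [set phi x | x in [set x | `|x| <= 1]].
- by exists (phi 0), 0 => //=; rewrite normr0.
- by move=> a [? _ <-].
have d0 : 0 < d.
  apply: lt_le_trans (exprn_gt0 2 e0) _; apply/ler_addgt0Pr => eta /phid.
  by move=> [_ [x x1 <-]] /ltW; apply: le_trans; exact: phie.
pose D : K := \sum_(f <- l) (2 * `|f|) ^+ 2.
have D0 : 0 <= D by apply: sumr_ge0 => f _; rewrite exprn_ge0// mulr_ge0.
have dD : 0 < d + 1 + D by rewrite ltr_wpDr// addr_gt0.
(* Step length: with [phi x < d + t ^+ 2], the first-order estimate below has error [t * (1 + D)],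
   which must stay below [d *+ 2] to contradict [d <= phi x]. *)
have [t [t0 t1 tD]] : exists t : K, [/\ 0 < t, t <= 1 & t * (1 + D) < d *+ 2].
  exists (d / (d + 1 + D)); split; first by rewrite divr_gt0.
    by rewrite ler_pdivrMr// mul1r -addrA lerDl addr_ge0.
  apply: (@le_lt_trans _ _ d); last by rewrite mulr2n ltrDl.
  by rewrite mulrAC ler_pdivrMr// ler_wpM2l ?(ltW d0)// -addrA lerDr ltW.
have [_ [x /= x1 <-] phix] := phid _ (exprn_gt0 2 t0).
(* The inner product with the residual; the conjugates turn [F g - g x] into a sum of squared
   moduli. *)
pose g : dual X := \sum_(f <- l) c (F f - f x) *: f.
have gE y : g y = \sum_(f <- l) c (F f - f x) * f y by exact: dual_sumE.
have Fg : F g - g x = phi x.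
  rewrite gE linear_sum /phi -sumrB; apply: eq_bigr => f _.
  by rewrite linearZ /= -mulrBr cN.
(* First-order condition at a near-minimum: a move of length [t] towards [y] stays in the ball, so
   [phi] stays at least [d]; expand and divide by [t]. *)
have gy y : `|y| <= 1 -> g y + c (g y) <= g x + c (g x) + t * (1 + D).
  move=> y1.
  pose z := (1 - t) *: x + t *: y.
  have z1 : `|z| <= 1.
    rewrite (le_trans (ler_normD _ _))// !normrZ (gtr0_norm t0).
    rewrite ger0_norm ?subr_ge0// -[leRHS](subrK t).
    by rewrite lerD// ler_piMr ?subr_ge0// ltW.
  have phiz : phi z = phi x - t * ((g y - g x) + c (g y - g x)) +
      t ^+ 2 * \sum_(f <- l) `|f y - f x| ^+ 2.
    rewrite !gE -sumrB raddf_sum -big_split /= !mulr_sumr -sumrB -big_split /=.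
    apply: eq_bigr => f _; set u := f y - f x; set w := F f - f x.
    have -> : F f - f z = w - t * u.
      have -> : f z = (1 - t) * f x + t * f y by rewrite linearD !linearZ.
      by rewrite /w /u; ring.
    rewrite -mulrBr -/u; clearbody u w.
    by rewrite -!cN rmorphB !rmorphM /= cK (c_ge0 t (ltW t0)); ring.
  have /= := dphi _ (ex_intro2 _ _ z z1 erefl).
  have uD : \sum_(f <- l) `|f y - f x| ^+ 2 <= D.
    apply: ler_sum => f _; rewrite lerXn2r ?nnegrE ?mulr_ge0//.
    rewrite (le_trans (ler_normB _ _))// mulr_natl mulr2n.
    by rewrite lerD// dual_norm_ub.
  rewrite phiz addrAC lerBrDr -lerBrDl => tS.
  rewrite -lerBlDl -(ler_pM2l t0).
  have -> : g y + c (g y) - (g x + c (g x)) = g y - g x + c (g y - g x).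
    by rewrite rmorphB; ring.
  apply: le_trans tS _.
  have -> : t * (t * (1 + D)) = d + t ^+ 2 + t ^+ 2 * D - d by ring.
  by rewrite lerD2r lerD ?(ltW phix)// ler_wpM2l// exprn_ge0// ltW.
have gb : `|g| *+ 2 <= g x + c (g x) + t * (1 + D).
  rewrite -mulr_natr -ler_pdivlMr//; apply: dual_norm_le => y y1.
  rewrite ler_pdivlMr// mulr_natr.
  (* A phase that makes [g y] equal to its modulus; it is 0 when [g y] is 0. *)
  pose u : K := `|g y| / g y.
  have guy : g (u *: y) = `|g y|.
    rewrite linearZ /= /u; have [->|gy0] := eqVneq (g y : K) 0.
      by rewrite normr0 scaler0.
    by rewrite -[_ *: _]/(_ * _) divfK.
  have := gy (u *: y); rewrite guy (c_ge0 _ (normr_ge0 _)) -mulr2n; apply.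
  rewrite normrZ /u normrM normfV normr_id.
  have [->|gy0] := eqVneq (g y : K) 0; first by rewrite normr0 !mul0r.
  by rewrite divff ?mul1r// normr_eq0.
have : d *+ 2 <= t * (1 + D).
  apply: (@le_trans _ _ (phi x *+ 2)); first by rewrite lerMn2r dphi//; exists x.
  have -> : phi x *+ 2 = (F g + c (F g)) - (g x + c (g x)).
    by rewrite mulr2n -{2}(c_ge0 _ (phi0 x)) -Fg rmorphB; ring.
  rewrite lerBlDl; apply: le_trans gb; apply: le_trans (cRe _) _.
  rewrite mulr_natl lerMn2r/= (le_trans (dual_norm_bound _ _))//.
  by rewrite ler_piMl.
by move=> /le_lt_trans/(_ tD); rewrite ltxx.
Qed.

End Goldstine.

(** * Half-graphs and their descent to the predual *)

Section HalfGraph.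
Context {R : realType} {s : scalar_kind}.
Local Notation K := (scalar_field R s).

(** The witnesses, [m] included, may change with [n] and [e], so each instance is a finite set of
    conditions. The pairing [p] is a parameter in order to cover both the dual and the predual. *)
Definition half_graphs (B : normedAlgType K) (Y : normedModType K)
    (p : Y -> B -> K) (al be : K) : Prop :=
  forall (n : nat) (e : K), 0 < e -> exists (a b : nat -> B) (m : Y),
    [/\ forall i, `|a i| <= 1, forall j, `|b j| <= 1, `|m| <= 1 &
      forall i j, (i < n)%N -> (j < n)%N ->
        `|p m (amul (a i) (b j)) - (if (i <= j)%N then al else be)| < e].

Lemma distr_trans (x y z : K) (e1 e2 : K) :
  `|x - y| < e1 -> `|y - z| < e2 -> `|x - z| < e1 + e2.
Proof.
by move=> h1 h2; apply: le_lt_trans (ler_distD y _ _) _; rewrite ltrD.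
Qed.

Lemma arens_half_graphs (B : normedAlgType K) (F G : dual (dual B))
    (mu : dual B) :
  `|F| <= 1 -> `|G| <= 1 -> `|mu| <= 1 ->
  half_graphs (@dual_fun R s B) (arens1 F G mu) (arens2 F G mu).
Proof.
move=> F1 G1 mu1 n e e0; have e20 : 0 < e / 2 by rewrite divr_gt0.
(* The last two clauses are the induction invariant: old points must already be close to the limits
   that new points will approximate. *)
suff [a [b [a1 b1 ab aG bF]]] : exists a b : nat -> B,
    [/\ forall i, `|a i| <= 1, forall j, `|b j| <= 1,
      forall i j, (i < n)%N -> (j < n)%N ->
        `|mu (amul (a i) (b j)) -
          (if (i <= j)%N then arens1 F G mu else arens2 F G mu)| < e,
      forall i, (i < n)%N -> `|bilact G mu (a i) - arens1 F G mu| < e / 2 &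
      forall j, (j < n)%N -> `|biract mu F (b j) - arens2 F G mu| < e / 2].
  by exists a, b, mu.
elim: n => [|n [a [b [a1 b1 ab aG bF]]]].
  by exists (fun=> 0), (fun=> 0); split=> // ?; rewrite normr0.
(* The new row imitates [F] on the old columns, which gives the value [arens2]. *)
have [x x1 Fx] := goldstine
  (bilact G mu :: [seq lact (b j) mu | j <- iota 0 n]) F1 e20.
pose a' i := if (i < n)%N then a i else x.
have a'G i : `|bilact G mu (a' i) - arens1 F G mu| < e / 2.
  rewrite /a'; case: ifPn => [/aG//|_]; rewrite distrC.
  by rewrite arens1E; apply: Fx; rewrite mem_head.
(* Chosen after [x], the new column imitates [G] on all rows including the new one, so the diagonal
   gets the value [arens1]. *)
have [y y1 Gy] := goldstine
  (biract mu F :: [seq ract mu (a' i) | i <- iota 0 n.+1]) G1 e20.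
pose b' i := if (i < n)%N then b i else y.
have b'F i : `|biract mu F (b' i) - arens2 F G mu| < e / 2.
  rewrite /b'; case: ifPn => [/bF//|_]; rewrite distrC.
  by rewrite arens2E; apply: Gy; rewrite mem_head.
exists a', b'; split => //.
- by move=> i; rewrite /a'; case: ifP.
- by move=> i; rewrite /b'; case: ifP.
move=> i j; rewrite !ltnS => ilen jlen.
have [jn|nj] := ltnP j n; last first.
  have jE : j = n by apply/eqP; rewrite eqn_leq jlen nj.
  rewrite jE ilen [e]splitr; apply: distr_trans (a'G i).
  rewrite distrC /b' ltnn -ractE bilactE; apply: Gy.
  rewrite inE; apply/orP; right; apply/mapP; exists i => //.
  by rewrite mem_iota add0n ltnS.
have [iltn|ni] := ltnP i n; first by rewrite /a' /b' iltn jn; exact: ab.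
have iE : i = n by apply/eqP; rewrite eqn_leq ilen ni.
rewrite iE leqNgt jn /= [e]splitr; apply: distr_trans (b'F j).
rewrite distrC /b' /a' ltnn jn -lactE biractE; apply: Fx.
rewrite inE; apply/orP; right; apply/mapP; exists j => //.
by rewrite mem_iota.
Qed.

(** Goldstine is applied in turn to [M], to each [F i] and to each [G j], every choice being tested
    against the earlier ones. With the given half-graph this makes four errors of [e / 4]. *)
Lemma half_graphs_bidual (B : normedAlgType K) (al be : K) :
  half_graphs (@dual_fun R s (bidual B)) al be ->
  half_graphs (@dual_fun R s B) al be.
Proof.
move=> hg n e e0; have e40 : 0 < e / 2 / 2 by rewrite !divr_gt0.
have [F [G [M [F1 G1 M1 FGM]]]] := hg n _ e40.
have [mu mu1 Mmu] := @goldstine R s (dual B) M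
  [seq amul (F i) (G j) | i <- iota 0 n, j <- iota 0 n] _ M1 e40.
have [a ha] := choice (fun i =>
  let: ex_intro2 x x1 Fx := goldstine
    [seq bilact (G j) mu | j <- iota 0 n] (F1 i) e40 in
  ex_intro (fun x => `|x| <= 1 /\ _) x (conj x1 Fx)).
have [b hb] := choice (fun j =>
  let: ex_intro2 x x1 Gx := goldstine
    [seq ract mu (a i) | i <- iota 0 n] (G1 j) e40 in
  ex_intro (fun x => `|x| <= 1 /\ _) x (conj x1 Gx)).
exists a, b, mu; split => //.
- by move=> i; have [] := ha i.
- by move=> j; have [] := hb j.
move=> i j ilt jlt.
have Gb : `|(ract mu (a i) (b j) : K) - G j (ract mu (a i))| < e / 2 / 2.
  rewrite distrC; have [_] := hb j; apply; apply/mapP.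
  by exists i; rewrite ?mem_iota.
have Fa : `|(bilact (G j) mu (a i) : K) - F i (bilact (G j) mu)| < e / 2 / 2.
  rewrite distrC; have [_] := ha i; apply; apply/mapP.
  by exists j; rewrite ?mem_iota.
have Mm : `|(amul (F i) (G j) mu : K) - M (amul (F i) (G j))| < e / 2 / 2.
  rewrite distrC; apply: Mmu; apply/allpairsP.
  by exists (i, j); rewrite !mem_iota.
rewrite [e]splitr [e / 2]splitr.
exact: (distr_trans (distr_trans Gb Fa) (distr_trans Mm (FGM i j ilt jlt))).
Qed.

(** Through the inverse [j] of the isometry [to_dual], [mu] becomes an element of the bidual of the
    predual, which Goldstine approximates on the products by some [m]; [a] and [b] are kept. *)
Lemma half_graphs_predual (A : dualBanachAlgebra R s) (al be : K) :
  half_graphs (@dual_fun R s A) al be ->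
  half_graphs (fun (m : predual A) (a : A) => @to_dual R s A a m : K) al be.
Proof.
move=> hg n e e0; have e20 : 0 < e / 2 by rewrite divr_gt0.
have [a [b [mu [a1 b1 mu1 abmu]]]] := hg n _ e20.
have [j jK] := choice (@to_dual_surj R s A).
have Kj x : j (@to_dual R s A x) = x.
  apply/eqP; rewrite -subr_eq0 -normr_eq0 -to_dual_norm linearB /= jK subrr.
  by rewrite normr0.
have jl : linear (fun f => mu (j f) : K^o).
  by move=> k f g; rewrite -linearP -[in LHS](jK f) -[in LHS](jK g) -linearP Kj.
have jb f : `|mu (j f)| <= 1 * `|f|.
  rewrite -{2}(jK f) to_dual_norm (le_trans (dual_norm_bound _ _))//.
  by rewrite ler_wpM2r.
have [m m1 hm] := @goldstine R s (predual A) (mk_dual ler01 jl jb)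
  [seq @to_dual R s A (amul (a i) (b k)) | i <- iota 0 n, k <- iota 0 n] _
  (mk_dual_norm ler01 jl jb) e20.
exists a, b, m; split => // i k ilt klt.
have hik : `|(@to_dual R s A (amul (a i) (b k)) m : K) - mu (amul (a i) (b k))|
    < e / 2.
  rewrite distrC -{1}(Kj (amul _ _)); apply: hm; apply/allpairsP.
  by exists (i, k); rewrite !mem_iota.
by rewrite [e]splitr; exact: (distr_trans hik (abmu i k ilt klt)).
Qed.

End HalfGraph.

(** * The double limit criterion and ultrapowers *)

Section Wap.
Context {R : realType} {s : scalar_kind}.
Local Notation K := (scalar_field R s).

Lemma fmap_ultra (I T : Type) (U : set_system I) (f : I -> T) :
  UltraFilter U -> UltraFilter (f @ U).
Proof.
move=> UU; split; first exact: fmap_proper_filter.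
move=> G GG UG; apply/seteqP; split => // A GA.
have [//|UA] := in_ultra_setVsetC (f @^-1` A) UU.
have : G (A `&` ~` A) by apply: filterI => //; exact: UG.
by rewrite setICr => /filter_not_empty.
Qed.

Lemma free_ultrafilter :
  exists U : ultrafilter nat, eventually `<=` ultra_sets U.
Proof.
have [U [UU evU]] := ultraFilterLemma (F := eventually) _.
by exists (Ultrafilter UU).
Qed.

Lemma weak_space_eval_cvg (E : normedModType K) (F : set_system E)
    (FF : Filter F) (x : E) (f : dual E) :
  (F : set_system (weak_space E)) --> (x : weak_space E) ->
  (f y : K) @[y --> F] --> (f x : K).
Proof.
move=> Fx.
pose ev (y : weak_space E) : {ptws dual E -> K^o} := fun f => f y.
have evc : continuous ev by exact: initial_continuous.
have : ev @ F --> ev x by exact: (cvg_comp _ _ Fx (evc x)).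
by move=> /pointwise_cvgP/(_ f).
Qed.

(** One direction of Grothendieck's double limit criterion, with tolerance [e]: both iterated limits
    are the same number, which lies within [e] of [al] and of [be]. *)
Lemma wap_half_graph (B : normedAlgType K) (mu : dual B) (a b : nat -> B)
    (al be e : K) :
  wap B mu -> (forall i, `|a i| <= 1) -> (forall j, `|b j| <= 1) ->
  (forall i j,
    `|(mu (amul (a i) (b j)) : K) - (if (i <= j)%N then al else be)| <= e) ->
  `|al - be| <= e *+ 2.
Proof.
move=> [C TC [Ccpt _]] a1 b1 ab.
have [U evU] := free_ultrafilter.
have nab (nu : dual B) i : `|nu (a i)| <= `|nu|.
  apply: (le_trans (dual_norm_bound nu (a i))).
  by rewrite ler_piMr// ?dual_norm_ge0//.
have acvg (nu : dual B) : cvg ((nu (a i) : K) @[i --> ultra_sets U]).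
  exact: (@scalar_ultra_cvg R s nat U _ (fun i => nu (a i)) _ (nab nu)).
(* The weak-star limit of the [a i] in the bidual along [U]. *)
pose phi (nu : dual B) : K^o := lim ((nu (a i) : K) @[i --> ultra_sets U]).
have phil : linear phi.
  move=> k f g; apply: cvg_lim => //.
  have h : k * f (a i) + g (a i) @[i --> ultra_sets U] --> k * phi f + phi g.
    apply: (@cvgD K K^o); last exact: acvg.
    by apply: (@cvgM K); [exact: cvg_cst|exact: acvg].
  exact: h.
have phib nu : `|phi nu| <= 1 * `|nu|.
  rewrite mul1r; apply: (cvg_norm_le (acvg nu)).
  by apply: filterE => i /=; exact: nab.
pose Phi := mk_dual ler01 phil phib.
have evb i : linear (fun nu : dual B => nu (a i) : K^o) by [].
have evbb i (nu : dual B) : `|nu (a i)| <= 1 * `|nu| by rewrite mul1r.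
pose ev i := mk_dual ler01 (evb i) (evbb i).
pose G := (fun j => lact (b j) mu : weak_space (dual B)) @ ultra_sets U.
have GU : UltraFilter G by exact: fmap_ultra.
have GF : Filter G by exact: fmap_filter.
have GC : G C.
  by apply: (@filterE _ U) => j; apply: TC; exists (b j); rewrite /= ?b1.
move: Ccpt; rewrite compact_ultra => /(_ G GU GC)[lam [_ Glam]].
have lim_le (u : nat -> K) l k : u i @[i --> ultra_sets U] --> l ->
    (\forall i \near \oo, `|u i - k| <= e) -> `|l - k| <= e.
  move=> ul ue.
  have h : u i - k @[i --> ultra_sets U] --> l - k.
    by apply: (@cvgB K K^o _ _ _ _ _ _ _ ul); exact: cvg_cst.
  by apply: (@cvg_norm_le K K^o _ _ _ _ _ _ h); exact: evU.
(* [Phi lam] is the double limit of [mu (a_i b_j)] in [j] then [i], and also,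
   [lam] being a weak limit, the one in [i] then [j]. *)
have lama i : `|(lam (a i) : K) - al| <= e.
  apply: (lim_le (fun j => mu (amul (a i) (b j)))).
    exact: (@weak_space_eval_cvg (dual B) G GF lam (ev i) Glam).
  by exists i => // j /= ij; have := ab i j; rewrite ij.
have Philam : `|(Phi lam : K) - al| <= e.
  apply: (lim_le (fun i => lam (a i)) _ _ (acvg lam)); exact: nearW.
have Phib : `|(Phi lam : K) - be| <= e.
  apply: (lim_le (fun j => Phi (lact (b j) mu))).
    exact: (@weak_space_eval_cvg (dual B) G GF lam Phi Glam).
  apply: nearW => j.
  apply: (lim_le (fun i => mu (amul (a i) (b j))) _ _ (acvg (lact (b j) mu))).
  (* The diagonal carries [al], so [be] starts at [i = j + 1]. *)
  by exists j.+1 => // i /= ji; have := ab i j; rewrite leqNgt ji.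
rewrite mulr2n (le_trans (ler_distD (Phi lam : K) _ _))// lerD//.
by rewrite distrC.
Qed.

(** Coordinate [n] of the ultrapower holds a half-graph of size [n]; each pair [(i, j)] is
    controlled in all but finitely many coordinates, which a free ultrafilter ignores. *)
Lemma wap_not_half_graphs (A : dualBanachAlgebra R s) (al be : K) :
  (forall (I : Type) (U : ultrafilter I),
      range (@ultra_pairing R s A I U) `<=` wap (ultrapower U A)) ->
  half_graphs (fun (m : predual A) (a : A) => @to_dual R s A a m : K) al be ->
  al = be.
Proof.
move=> hWAP hg; apply: contrapT => albe.
(* A third of the gap, since the double limit bound is [e *+ 2]. *)
pose e : K := `|al - be| / 3.
have e0 : 0 < e by rewrite divr_gt0// normr_gt0 subr_eq0; exact/eqP.
have [a0 /choice[b0 /choice[m0 h]]] := choice (hg^~ e ^~ e0).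
have [U evU] := free_ultrafilter.
have bda i : (fun n => a0 n i) \in @bounded_family R s A nat.
  by apply/asboolP; exists 1 => n; have [] := h n.
have bdb i : (fun n => b0 n i) \in @bounded_family R s A nat.
  by apply/asboolP; exists 1 => n; have [] := h n.
have bdm : m0 \in @bounded_family R s (predual A) nat.
  by apply/asboolP; exists 1 => n; have [] := h n.
have pi1 (E : normedModType K) (x : linfty E nat) :
    (forall n, `|x n| <= 1) -> `|\pi_(ultrapower U E)%qT x| <= 1.
  move=> x1; exact: (cvg_ler (@ultra_norm_cvg _ _ _ U _ x) (cvg_cst (1 : K))).
have : `|al - be| <= e *+ 2.
  apply: (@wap_half_graph (ultrapower U A)
    (ultra_pairing (\pi_(ultrapower U (predual A))%qT (Linfty bdm)))
    (fun i => \pi_(ultrapower U A)%qT (Linfty (bda i)))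
    (fun i => \pi_(ultrapower U A)%qT (Linfty (bdb i)))).
  - by apply: hWAP; exists (\pi_(ultrapower U (predual A))%qT (Linfty bdm)).
  - by move=> i; apply: pi1 => n; have [+ _ _ _] := h n; exact.
  - by move=> i; apply: pi1 => n; have [_ + _ _] := h n; exact.
  move=> i j; rewrite [amul _ _]ultra_mul_pi.
  have hm := @ultra_pairing_fun_cvg R s A nat U (Linfty bdm)
    (linfty_mul (Linfty (bda i)) (Linfty (bdb j))).
  set k := if _ then _ else _.
  have hk : (@to_dual R s A (amul (a0 n i) (b0 n j)) (m0 n) : K) - k
      @[n --> ultra_sets U] -->
      (ultra_pairing (\pi_(ultrapower U (predual A))%qT (Linfty bdm))
        (\pi_(ultrapower U A)%qT
          (linfty_mul (Linfty (bda i)) (Linfty (bdb j)))) : K) - k.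
    by apply: (@cvgB K K^o _ _ _ _ _ _ _ hm); exact: cvg_cst.
  apply: (@cvg_norm_le K K^o _ _ _ _ _ _ hk); apply: evU.
  exists (maxn i j).+1 => // n /=; rewrite gtn_max => /andP[ilt jlt].
  by apply: ltW; have [_ _ _] := h n; exact.
have -> : `|al - be| = e *+ 3 by rewrite -mulr_natr divfK// pnatr_eq0.
by rewrite mulrS gerDr => /(lt_le_trans e0); rewrite ltxx.
Qed.

End Wap.

(** * Arens regularity of the even duals *)

Lemma no_half_graphs_arens_regular (R : realType) (s : scalar_kind)
    (B : normedAlgType (scalar_field R s)) :
  (forall al be, half_graphs (@dual_fun R s B) al be -> al = be) ->
  arens_regular B.
Proof.
move=> hB; suff E (F G : dual (dual B)) : arens1 F G = arens2 F G by exact: E.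
apply: dual_ext => mu.
(* One factor brings [F], [G] and [mu] into the unit balls; by trilinearity both values are
   multiplied by [r ^+ 3], which is nonzero. The added 1 keeps the inverse positive when all three
   vanish. *)
pose r : scalar_field R s := (`|F| + `|G| + `|mu| + 1)^-1.
have r1 : 0 < `|F| + `|G| + `|mu| + 1 by rewrite ltr_wpDl// !addr_ge0.
have r0 : 0 < r by rewrite invr_gt0.
have F1 : `|r *: F| <= 1.
  rewrite normrZ gtr0_norm// mulrC ler_pdivrMr// mul1r -!addrA lerDl.
  by rewrite !addr_ge0.
have G1 : `|r *: G| <= 1.
  rewrite normrZ gtr0_norm// mulrC ler_pdivrMr// mul1r -!addrA addrCA lerDl.
  by rewrite !addr_ge0.
have mu1 : `|r *: mu| <= 1.
  rewrite normrZ gtr0_norm// mulrC ler_pdivrMr// mul1r addrAC lerDr.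
  by rewrite !addr_ge0.
have := hB _ _ (arens_half_graphs F1 G1 mu1).
have -> : arens1 (r *: F) (r *: G) (r *: mu) = r ^+ 3 * arens1 F G mu.
  have H : bilact (r *: G) (r *: mu) = r ^+ 2 *: (bilact G mu).
    apply: dual_ext => a; rewrite dual_scaleE !bilactE dual_scaleE.
    have -> : ract (r *: mu) a = r *: ract mu a by exact: dual_ext.
    by rewrite linearZ /= mulrA expr2.
  rewrite !arens1E H dual_scaleE.
  have -> : F (r ^+ 2 *: bilact G mu) = r ^+ 2 * F (bilact G mu).
    exact: linearZ.
  by ring.
have -> : arens2 (r *: F) (r *: G) (r *: mu) = r ^+ 3 * arens2 F G mu.
  have H : biract (r *: mu) (r *: F) = r ^+ 2 *: (biract mu F).
    apply: dual_ext => a; rewrite dual_scaleE !biractE dual_scaleE.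
    have -> : lact a (r *: mu) = r *: lact a mu by exact: dual_ext.
    by rewrite linearZ /= mulrA expr2.
  rewrite !arens2E H dual_scaleE.
  have -> : G (r ^+ 2 *: biract mu F) = r ^+ 2 * G (biract mu F).
    exact: linearZ.
  by ring.
by move/mulfI; apply; rewrite expf_neq0// gt_eqF.
Qed.

Theorem proposition3p6 (R : realType) (s : scalar_kind)
    (A : dualBanachAlgebra R s)
    (hWAP : forall (I : Type) (U : ultrafilter I),
      range (@ultra_pairing R s A I U) `<=` wap (ultrapower U A))
    (n : nat) :
  arens_regular (even_dual A n).
Proof.
apply: no_half_graphs_arens_regular => al be hg.
apply: (wap_not_half_graphs hWAP); apply: half_graphs_predual.
(* Each descent by one bidual keeps the two values [al] and [be]. *)
by elim: n hg => // n IHn hg; apply/IHn/half_graphs_bidual.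
Qed.
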